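(* For every integer $k\ge 2$ there exist constants $c>0$ and $N_0$, depending only on $k$, such that the following holds for all positive integers $N\ge N_0$ and $T$ with $$(\log N)^3\le T\le N^{1/(4k)} .$$ Let $H=\{H_2,\dots,H_k\}$ be a hypergraph on $N$ vertices with the BOUQUET property. If $$\Delta_1(H_i)\le T^{i-1}(\log T)^{\frac{k-i}{k-1}}\ \text{ for } 2\le i\le k\qquad\text{and}\qquad \Delta_{i-1}(H_i)\le\frac{T}{(\log T)^{i+1}}\ \text{ for } 3\le i\le k,$$ then $$\alpha(H)\ \ge\ c\,\frac NT(\log T)^{1/(k-1)} .$$
   Context: A hypergraph $H=\{H_2,\dots,H_k\}$ on a finite vertex set $V$ is a family of subsets of $V$ (edges) where $H_i$ is the set of edges of size $i$ (each $H_i$ is an $i$-uniform hypergraph on $V$). An independent set is a set of vertices containing no edge of $H$, and $\alpha(H)$ is the size of a largest one. $\Delta_\ell(H_i)$ is the maximum, over all $\ell$-subsets $S$ of $V$, of the number of edges of $H_i$ containing $S$. All logarithms are natural. A linear $3$-cycle consists of three edges $e_1,e_2,e_3$ such that $e_1\cap e_2=\{v_1\}$, $e_2\cap e_3=\{v_2\}$, $e_3\cap e_1=\{v_3\}$ for distinct vertices $v_1,v_2,v_3$. A $4$-cycle consists of four distinct edges $e_1,\dots,e_4$ for which there exist distinct vertices $v_1,\dots,v_4$ with $v_i\in e_i\cap e_{i+1}$ for $i=1,\dots,4$ (where $e_5=e_1$); it has clean intersections if $e_1\cap e_3=e_2\cap e_4=\emptyset$. $H$ has the BOUQUET property if: (i)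 if $e\in H_i$ and $f\in H_j$ with $i\ne j$, then $|e\cap f|\le 1$; (ii) for every $2\le i\le k$, any two distinct edges of $H_i$ intersect in $0$, $1$ or $i-1$ vertices; (iii) $H$ contains no linear $3$-cycle unless at least two edges of the cycle are in $H_2$; (iv) $H$ contains no $4$-cycle with clean intersections; (v) there are no three edges $e_1,e_2,e_3\in H_3$ with $|e_1\cap e_2|=|e_2\cap e_3|=2$ and $|e_1\cap e_3|=1$. *)

(* Defs.v *)
From HB Require Import structures.
From mathcomp Require Import all_boot all_order all_algebra.
From mathcomp Require Import reals exp.

Set Implicit Arguments.
Unset Strict Implicit.
Unset Printing Implicit Defensive.

(* A hypergraph on V is its set of edges H : {set {set V}}; the condition that
   H is of the form {H_2, ..., H_k} is [edge_sizes_in]. *)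
Section Hypergraph.
Variable V : finType.
Implicit Types (H : {set {set V}}) (e f A S : {set V}).

Definition edge_sizes_in (lo hi : nat) H : Prop :=
  forall e, e \in H -> lo <= #|e| <= hi.

Definition layer H (i : nat) : {set {set V}} := [set e in H | #|e| == i].

Definition independent H A : bool := [forall e in H, ~~ (e \subset A)].

Definition alpha H : nat := \max_(A : {set V} | independent H A) #|A|.

Definition max_codegree (l : nat) H : nat :=
  \max_(S : {set V} | #|S| == l) #|[set e in H | S \subset e]|.

Definition linear_3cycle e1 e2 e3 : Prop :=
  exists v1 v2 v3 : V,
    [/\ uniq [:: v1; v2; v3],
        e1 :&: e2 = [set v1], e2 :&: e3 = [set v2] & e3 :&: e1 = [set v3]].

Definition is_4cycle e1 e2 e3 e4 : Prop :=
  uniq [:: e1; e2; e3; e4] /\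
  exists v1 v2 v3 v4 : V,
    uniq [:: v1; v2; v3; v4] /\
    [/\ v1 \in e1 :&: e2, v2 \in e2 :&: e3, v3 \in e3 :&: e4 &
        v4 \in e4 :&: e1].

Definition clean_intersections e1 e2 e3 e4 : Prop :=
  e1 :&: e3 = set0 /\ e2 :&: e4 = set0.

Record bouquet (k : nat) H : Prop := Bouquet {
  bouquet_cross : forall (i j : nat) e f,
    i != j -> e \in layer H i -> f \in layer H j -> #|e :&: f| <= 1;
  bouquet_same : forall (i : nat) e f,
    2 <= i <= k -> e \in layer H i -> f \in layer H i -> e != f ->
    #|e :&: f| \in [:: 0; 1; i.-1];
  (* The edges of a linear 3-cycle are automatically distinct, so the
     cardinality below counts edges of the cycle. *)
  bouquet_3cycle : forall e1 e2 e3,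
    e1 \in H -> e2 \in H -> e3 \in H -> linear_3cycle e1 e2 e3 ->
    2 <= #|[set e1; e2; e3] :&: layer H 2|;
  bouquet_4cycle : forall e1 e2 e3 e4,
    e1 \in H -> e2 \in H -> e3 \in H -> e4 \in H ->
    is_4cycle e1 e2 e3 e4 -> ~ clean_intersections e1 e2 e3 e4;
  bouquet_triple : forall e1 e2 e3,
    e1 \in layer H 3 -> e2 \in layer H 3 -> e3 \in layer H 3 ->
    ~ [/\ #|e1 :&: e2| = 2, #|e2 :&: e3| = 2 & #|e1 :&: e3| = 1]
}.

End Hypergraph.

(* Main.v *)
Require Import Defs.
From HB Require Import structures.
From mathcomp Require Import all_boot all_order all_algebra.
From mathcomp Require Import reals sequences exp.
From mathcomp Require Import zify ring lra.

Set Implicit Arguments.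
Unset Strict Implicit.
Unset Printing Implicit Defensive.

Import Order.TTheory GRing.Theory Num.Theory.

(** Vertices are selected one at a time. A state consists of the set [W] of the
    selected vertices and of a set [A] of alive vertices, from which the next
    one is taken. An edge [e] leaves the residue [e :\: W]; as long as every
    residue inside [A] has at least two vertices, [W] is independent and any
    alive vertex can be selected ([admissible_select]). Selecting [v] kills the
    alive [u] such that [[set u; v]] is a residue, and it turns the residues of
    size [i + 1] through [v] into residues of size [i].

    Progress is measured by one linear quantity, the number of alive vertices
    minus a weighted number of residues,
      [potential = |A| - sum_i a_i e_i],
    where [e_i] counts the residues of size [i] inside [A]. That the potential
    is linear lets an average over the next vertex replace any control of
    the fluctuations of degrees, for two reasons.

    First, [A] may be shrunk until the potential is maximal. No further deletion
    of a vertex [u] then raises it, which says that [sum_i a_i d_i(u) <= 1]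
    ([potential_maximal]). So the maximum degrees are of the order of the
    averages that the weights are designed for; in particular each vertex has at
    most [1 / a_2] neighbours in the graph of the residues of size two. Moreover
    deleting [u] costs [1 - sum_i a_i d_i(u) >= 0], so the loss may be estimated
    as if all vertices died at one common rate [x >= 1 / a_2], instead of the
    rate given by their own number of neighbours.

    Second, by the bouquet property two vertices have at most one common
    neighbour in that graph ([adj_codegree]). So a random alive vertex hits a
    residue of size [i] nearly as often as the degrees of its vertices add up to
    ([sum_live_select]), and at a common rate of death residues of size [i] die
    [i] times as fast as vertices do.

    If a fraction [q] of the vertices survives, [e_i] therefore shrinks like
    [q ^ i], and [a_i] may grow like [q ^ (1 - i)]. A residue that shrinks
    counts with a larger weight from then on; this is paid for by an additional
    factor of the weights that falls linearly from 2 to 1 during the whole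
    process ([weight_decay]).
    Put [s = (ln T) ^ (1 / (k - 1))]. Initially [e_i] is at most
    [N T ^ (i - 1) s ^ (k - i)], so that weights of order
    [1 / (T ^ (i - 1) s ^ (k - i))] give a potential of at least [N / 2]. Then
    [1 / a_2] is of order [q T s ^ (k - 2)] and each selection kills a fraction
    of order [T s ^ (k - 2) / N] of the vertices. After [s N / (32 k T)]
    selections this amounts to [q] of about [exp (- s ^ (k - 1) / 2)], that is
    [T ^ (- 1 / 2)]: the process has not died out by then, and it has selected
    as many vertices as the theorem asks for. *)

(** * Two counting tools *)

Lemma sum_card_double_count (I J : finType) (A : {set I}) (B : {set J})
    (r : I -> J -> bool) (w : I -> nat) :
  \sum_(i in A) #|[set j in B | r i j]| * w i =
  \sum_(j in B) \sum_(i in A | r i j) w i.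
Proof.
rewrite (exchange_big_dep (mem A)) /=; last by move=> j i _ /andP[].
apply: eq_bigr => i iA; rewrite -sum1dep_card big_distrl /=.
by apply: eq_big => [j|j _]; rewrite ?iA ?mul1n.
Qed.

Lemma card_bigcup_le (I T : finType) (B : {set I}) (F : I -> {set T}) :
  #|\bigcup_(i in B) F i| <= \sum_(i in B) #|F i|.
Proof.
elim/big_ind2: _ => [|m S n S' SS' mm|//]; first by rewrite cards0.
by apply: leq_trans (leq_card_setU _ _) _; apply: leq_add.
Qed.

(** A Bonferroni inequality: what a member of the family adds to the union misses
    at most one element for each earlier member. *)
Lemma sum_card_le_bigcup (I T : finType) (B : {set I}) (F : I -> {set T}) :
    {in B &, forall i j, i != j -> #|F i :&: F j| <= 1} ->
  \sum_(i in B) #|F i| <= #|\bigcup_(i in B) F i| + #|B| ^ 2.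
Proof.
move: {2}#|B| (erefl #|B|) => n; elim: n B => [|n IH] B cardB smallI.
  by move/eqP: cardB; rewrite cards_eq0 => /eqP->; rewrite !big_set0.
have /card_gt0P[x xB] : 0 < #|B| by rewrite cardB.
have cardB' : #|B :\ x| = n by move: cardB; rewrite (cardsD1 x) xB => -[].
have {}IH := IH _ cardB' (fun i j iB jB => smallI i j (subsetP (subD1set B x) i iB)
  (subsetP (subD1set B x) j jB)).
rewrite (big_setD1 x xB) (big_setD1 x xB) /= cardsU cardB.
have I_le : #|F x :&: \bigcup_(i in B :\ x) F i| <= n.
  rewrite big_distrr /= (leq_trans (card_bigcup_le _ _)) // -cardB' -sum1_card.
  apply: leq_sum => i; rewrite !inE => /andP[ix iB].
  by apply: smallI => //; rewrite eq_sym.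
have := subset_leq_card (subsetIl (F x) (\bigcup_(i in B :\ x) F i)).
by move: IH; rewrite cardB'; nia.
Qed.

(** * Residues of the edges *)

Section Residual.
Variables (V : finType) (H : {set {set V}}) (k : nat).
Implicit Types (W A e f g : {set V}) (u v x y z : V).

(** Residues are counted with multiplicity, through the edges that leave them:
    two edges with the same residue count twice. *)
Definition live W A i : {set {set V}} :=
  [set e in H | (e :\: W \subset A) && (#|e :\: W| == i)].

Definition adj W u v : bool :=
  (u != v) && [exists e in H, e :\: W == [set u; v]].

Definition nbrs W A v : {set V} := [set u in A | adj W u v].

Lemma adjC W u v : adj W u v = adj W v u.
Proof. by rewrite /adj eq_sym setUC. Qed.

Lemma adjP W u v :
  reflect (u != v /\ exists2 e, e \in H & e :\: W = [set u; v]) (adj W u v).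
Proof.
apply: (iffP andP) => [[uv /existsP[e /andP[eH /eqP eW]]]|[uv [e eH eW]]].
  by split=> //; exists e.
by split=> //; apply/existsP; exists e; rewrite eH eW eqxx.
Qed.

Hypothesis sizeH : edge_sizes_in 2 k H.
Hypothesis bouqH : bouquet k H.

Lemma mem_residual2 W e x y w : e :\: W = [set x; y] ->
  (w \in e) = (w \in e :&: W) || (w == x) || (w == y).
Proof.
move=> eW; rewrite -{1}(setID e W) eW !inE; by case: (w \in e); case: (w \in W).
Qed.

(** Edges that share two vertices have the same size and differ in one vertex
    each. As [y] and [z] already tell them apart, they agree inside [W]. *)
Lemma residual_sunflower W e f x y z :
    e \in H -> f \in H -> y != z -> x != y -> x != z ->
    e :\: W = [set x; y] -> f :\: W = [set x; z] -> 1 < #|e :&: f| ->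
  #|e| = #|f| /\ e :&: W = f :&: W.
Proof.
move=> eH fH yz xy xz eW fW ef.
have eLf : #|e| = #|f|.
  apply/eqP; apply: contraTT ef => neq; rewrite -leqNgt.
  by apply: (bouquet_cross bouqH neq); rewrite inE eqxx andbT.
have neq_ef : e != f.
  apply: contraNneq yz => ef'; move: (eW); rewrite ef' fW => /setP/(_ y).
  by rewrite !inE eqxx orbT eq_sym (negPf xy) /= => ->.
have yW : y \notin W.
  by have: y \in e :\: W; [rewrite eW !inE eqxx orbT | rewrite inE => /andP[]].
have zW : z \notin W.
  by have: z \in f :\: W; [rewrite fW !inE eqxx orbT | rewrite inE => /andP[]].
have ye : y \in e by rewrite (mem_residual2 _ eW) eqxx orbT.
have zf : z \in f by rewrite (mem_residual2 _ fW) eqxx orbT.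
have yf : y \notin f.
  by rewrite (mem_residual2 _ fW) inE (negPf yW) andbF (eq_sym y x) (negPf xy).
have ze : z \notin e.
  by rewrite (mem_residual2 _ eW) inE (negPf zW) andbF eq_sym (negPf xz)
     eq_sym (negPf yz).
have cardI : #|e :&: f| = #|e|.-1.
  have := bouquet_same bouqH (sizeH eH) _ _ neq_ef.
  rewrite !inE eLf !eqxx eH fH => /(_ isT isT).
  by case/or3P => /eqP // E; move: ef; rewrite E.
have esub : e :\: f = [set y].
  apply/esym/eqP; rewrite eqEcard sub1set inE ye yf cards1 /= -(leq_add2l #|e :&: f|).
  by rewrite cardsID cardI; case: #|e| (sizeH eH) => //= m _; rewrite addn1.
have fsub : f :\: e = [set z].
  apply/esym/eqP; rewrite eqEcard sub1set inE zf ze cards1 /= -(leq_add2l #|f :&: e|).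
  by rewrite cardsID setIC cardI -eLf; case: #|e| (sizeH eH) => //= m _; rewrite addn1.
split=> //; apply/setP=> w; rewrite !inE.
have [wW|] := boolP (w \in W); last by rewrite !andbF.
rewrite !andbT; apply/idP/idP => [we|wf].
  apply: contraTT wW => wf; have: w \in e :\: f by rewrite inE we wf.
  by rewrite esub inE => /eqP->.
apply: contraTT wW => we; have: w \in f :\: e by rewrite inE we wf.
by rewrite fsub inE => /eqP->.
Qed.

(** Three edges whose residues form a path [a - v - b - v'] would otherwise meet
    cyclically, in [v], in [b] and in a vertex [w] of [W]. If these are their only
    intersections they form a linear 3-cycle in which two edges have at least
    three vertices. If not, their parts in [W] coincide and the edges are
    three triples of the kind that the last clause of the bouquet property
    excludes. *)
Lemma residual_path_disjoint W g1 g2 g3 a v b v' :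
    g1 \in H -> g2 \in H -> g3 \in H -> uniq [:: a; v; b; v'] ->
    g1 :\: W = [set v; a] -> g2 :\: W = [set v; b] -> g3 :\: W = [set b; v'] ->
  g1 :&: g3 = set0.
Proof.
move=> H1 H2 H3 U E1 E2 E3.
have [av [ab [av' [vb [vv' bv']]]]] :
  a != v /\ a != b /\ a != v' /\ v != b /\ v != v' /\ b != v'.
  move: U; rewrite /= !inE !negb_or -!andbA.
  by case/and5P=> -> -> -> -> /and3P[-> -> _].
have nW x e y : e :\: W = [set x; y] -> x \notin W /\ y \notin W.
  move=> /setP E; split; [move: (E x)|move: (E y)];
    by rewrite !inE eqxx ?orbT => /andP[].
have va : v != a by rewrite eq_sym.
have bv : b != v by rewrite eq_sym.
have [vW aW] := nW _ _ _ E1; have [_ bW] := nW _ _ _ E2.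
have [_ v'W] := nW _ _ _ E3.
have m1 w := mem_residual2 w E1.
have m2 w := mem_residual2 w E2.
have m3 w := mem_residual2 w E3.
apply/eqP; rewrite -subset0; apply/subsetP=> w /setIP[w1 w3]; exfalso.
have wW : w \in W.
  apply: contraTT w1 => wW; rewrite m1 inE (negPf wW) andbF /=.
  move: w3; rewrite m3 inE (negPf wW) andbF /= => /orP[]/eqP->.
    by rewrite negb_or (eq_sym b v) vb eq_sym ab.
  by rewrite negb_or (eq_sym v' v) vv' eq_sym av'.
have neqW x : x \notin W -> w != x by apply: contraNneq => <-.
have v_g1 : v \in g1 by rewrite m1 eqxx orbT.
have a_g1 : a \in g1 by rewrite m1 eqxx orbT.
have v_g2 : v \in g2 by rewrite m2 eqxx orbT.
have b_g2 : b \in g2 by rewrite m2 eqxx orbT.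
have b_g3 : b \in g3 by rewrite m3 eqxx orbT.
have v_g3 : v \notin g3 by rewrite m3 inE (negPf vW) andbF /= negb_or vb vv'.
have a_g3 : a \notin g3 by rewrite m3 inE (negPf aW) andbF /= negb_or ab av'.
have gt1 (S : {set V}) x y : x \in S -> y \in S -> x != y -> 1 < #|S|.
  move=> xS yS xy; have <- : #|[set x; y]| = 2 by rewrite cards2 xy.
  by apply: subset_leq_card; apply/subsetP=> t; rewrite !inE => /orP[]/eqP->.
(* Both free vertices of g1 avoid g3, so g1 and g3 are too different to share a
   kernel and meet in w alone. *)
have I13 : g1 :&: g3 = [set w].
  apply/esym/eqP; rewrite eqEcard sub1set inE w1 w3 cards1 /= leqNgt.
  apply/negP=> I13.
  have L : #|g1| = #|g3|.
    apply/eqP; apply: contraTT I13 => neq; rewrite -leqNgt.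
    by apply: (bouquet_cross bouqH neq); rewrite inE eqxx andbT.
  have neq : g1 != g3 by apply: contraNneq v_g3 => <-.
  have C : #|g1 :&: g3| = #|g1|.-1.
    have := bouquet_same bouqH (sizeH H1) _ _ neq.
    rewrite !inE L !eqxx H1 H3 => /(_ isT isT).
    by case/or3P => /eqP // E; move: I13; rewrite E.
  have D : 1 < #|g1 :\: g3|.
    by apply: (gt1 _ v a); rewrite ?inE ?v_g1 ?v_g3 ?a_g1 ?a_g3 // eq_sym.
  move: D; rewrite -(ltn_add2l #|g1 :&: g3|) cardsID C.
  by case: #|g1| (sizeH H1) => //= m _; rewrite addn1 ltnn.
have g1_3 : 2 < #|g1|.
  by rewrite -(cardsID W g1) E1 cards2 (eq_sym v) av addn2 !ltnS card_gt0;
     apply/set0Pn; exists w; rewrite inE w1 wW.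
have g3_3 : 2 < #|g3|.
  by rewrite -(cardsID W g3) E3 cards2 bv' addn2 !ltnS card_gt0;
     apply/set0Pn; exists w; rewrite inE w3 wW.
have E2' : g2 :\: W = [set b; v] by rewrite E2 setUC.
have [|I12] := ltnP 1 #|g1 :&: g2|.
  (* All three edges share the kernel {w}, so they are triples. *)
  move=> I12; have [L12 K12] := residual_sunflower H1 H2 ab va vb E1 E2 I12.
  have w2 : w \in g2 by have: w \in g1 :&: W; [rewrite inE w1|rewrite K12 inE => /andP[]].
  have I23 : 1 < #|g2 :&: g3|.
    by apply: (gt1 _ w b); rewrite ?inE ?w2 ?w3 ?b_g2 ?b_g3 // neqW.
  have [L23 K23] := residual_sunflower H2 H3 vv' bv bv' E2' E3 I23.
  have K : g1 :&: W = [set w].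
    apply/eqP; rewrite eqEsubset sub1set inE w1 wW andbT -I13.
    by rewrite subsetI subsetIl K12 K23 subsetIl.
  have C1 : #|g1| = 3 by rewrite -(cardsID W g1) K E1 cards1 cards2 (eq_sym v) av.
  have lay e : e \in H -> #|e| = 3 -> e \in layer H 3 by move=> eH E; rewrite inE eH E.
  have two e f : e \in H -> f \in H -> e != f -> #|e| = 3 -> #|f| = 3 ->
      1 < #|e :&: f| -> #|e :&: f| = 2.
    move=> eH fH ef e3 f3 I; have := bouquet_same bouqH (sizeH eH) _ _ ef.
    rewrite !inE eH fH e3 f3 !eqxx => /(_ isT isT).
    by case/or3P => /eqP // E; move: I; rewrite E.
  apply: (bouquet_triple bouqH (lay _ H1 C1) (lay _ H2 _) (lay _ H3 _));
    rewrite -?L23 -?L12 //; split.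
  - apply: two; rewrite -?L12 //; apply: contraNneq a_g3 => g12.
    have: a \in g2 by rewrite -g12.
    by rewrite m2 inE (negPf aW) andbF /= (negPf av) (negPf ab).
  - apply: two; rewrite -?L23 -?L12 //.
    by apply: contraNneq v_g3 => <-.
  - by rewrite I13 cards1.
have w2 : w \notin g2.
  apply: contraTN I12 => w2; rewrite -ltnNge.
  by apply: (gt1 _ w v); rewrite ?inE ?w1 ?w2 ?v_g1 ?v_g2 // neqW.
have J12 : g1 :&: g2 = [set v].
  by apply/esym/eqP; rewrite eqEcard sub1set inE v_g1 v_g2 cards1.
have J23 : g2 :&: g3 = [set b].
  apply/esym/eqP; rewrite eqEcard sub1set inE b_g2 b_g3 cards1 /= leqNgt.
  apply/negP=> I23.
  have [_ K23] := residual_sunflower H2 H3 vv' bv bv' E2' E3 I23.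
  move: w2; have: w \in g3 :&: W by rewrite inE w3.
  by rewrite -K23 inE => /andP[->].
have lin : linear_3cycle g1 g2 g3.
  exists v, b, w; split=> //; last by rewrite setIC.
  by rewrite /= !inE !negb_or vb (eq_sym v) (eq_sym b) !neqW.
have := bouquet_3cycle bouqH H1 H2 H3 lin.
apply/negP; rewrite -ltnNge ltnS.
apply: (@leq_trans #|[set g2]|); last by rewrite cards1.
apply: subset_leq_card.
apply/subsetP=> e; rewrite !inE => /andP[/orP[/orP[]|]/eqP-> /andP[_ /eqP E]] //.
  by move: g1_3; rewrite E.
by move: g3_3; rewrite E.
Qed.

(** Two common neighbours give a 4-cycle of residues. Its opposite edges are the
    ends of a path of three residues, hence disjoint, so that the 4-cycle would
    have clean intersections. *)
Lemma adj_codegree W u1 u2 : u1 != u2 ->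
  #|[set v | adj W v u1 && adj W v u2]| <= 1.
Proof.
move=> u12; apply/card_le1P => v; rewrite !inE => /andP[A1 A2] v'.
rewrite !inE; apply/idP/eqP => [/andP[A1' A2']|->]; last by rewrite A1 A2.
apply/eqP; apply: contraTT isT => v'v.
have /adjP[vu1 [f1 F1 R1]] := A1; have /adjP[vu2 [f2 F2 R2]] := A2.
have /adjP[vu1' [f1' F1' R1']] := A1'; have /adjP[vu2' [f2' F2' R2']] := A2'.
have neq e f x y (S : {set V}) : e :\: W = [set x; y] -> f :\: W = S -> y \notin S -> e != f.
  by move=> E E' ny; apply: contraNneq ny => ef; rewrite -E' -ef E !inE eqxx orbT.
have neq' e f x y (S : {set V}) : e :\: W = [set x; y] -> f :\: W = S -> x \notin S -> e != f.
  by move=> E E' ny; apply: contraNneq ny => ef; rewrite -E' -ef E !inE eqxx.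
have U : uniq [:: u1; v; u2; v'].
  rewrite /= !inE !negb_or u12 (eq_sym u1) vu1 (eq_sym u1) vu1' vu2 (eq_sym v) v'v.
  by rewrite eq_sym vu2'.
have U' : uniq [:: u2; v; u1; v'].
  rewrite /= !inE !negb_or (eq_sym u2 u1) u12 (eq_sym u2) vu2 (eq_sym u2) vu2' vu1.
  by rewrite (eq_sym v) v'v eq_sym vu1'.
have D1 : f1 :&: f2' = set0.
  by apply: (residual_path_disjoint F1 F2 F2' U R1 R2); rewrite R2' setUC.
have D2 : f2 :&: f1' = set0.
  by apply: (residual_path_disjoint F2 F1 F1' U' R2 R1); rewrite R1' setUC.
case: (@bouquet_4cycle _ _ _ bouqH f1 f2 f2' f1' F1 F2 F2' F1') => //.
split.
  rewrite /= !inE !negb_or (neq _ _ _ _ _ R1 R2) ?(neq' _ _ _ _ _ R1 R2')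
    ?(neq' _ _ _ _ _ R1 R1') ?(neq' _ _ _ _ _ R2 R2') ?(neq' _ _ _ _ _ R2 R1')
    ?(neq _ _ _ _ _ R2' R1') //;
  by rewrite !inE ?negb_or ?(eq_sym v v') ?(eq_sym u2 u1) ?(eq_sym u1 v) ?(eq_sym u2 v')
     ?v'v ?u12 ?vu1 ?vu2 ?vu1' ?vu2'.
have inl e x y : e :\: W = [set x; y] -> x \in e.
  by move=> E; rewrite (mem_residual2 _ E) eqxx orbT.
have inr e x y : e :\: W = [set x; y] -> y \in e.
  by move=> E; rewrite (mem_residual2 _ E) eqxx orbT.
exists v, u2, v', u1; split.
  rewrite /= !inE !negb_or vu2 (eq_sym v) v'v vu1 (eq_sym u2) vu2' (eq_sym u2) u12.
  by rewrite vu1'.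
split; rewrite inE.
- by rewrite (inl _ _ _ R1) (inl _ _ _ R2).
- by rewrite (inr _ _ _ R2) (inr _ _ _ R2').
- by rewrite (inl _ _ _ R2') (inl _ _ _ R1').
- by rewrite (inr _ _ _ R1') (inr _ _ _ R1).
Qed.

Definition alive_after W A v := A :\: (v |: nbrs W A v).

Lemma nbrsC W A u v : u \in A -> v \in A ->
  (u \in nbrs W A v) = (v \in nbrs W A u).
Proof. by move=> uA vA; rewrite !inE uA vA adjC. Qed.

Lemma live_select_sub W A v i : v \in A -> v \notin W ->
  live (v |: W) (alive_after W A v) i \subset
    [set e in live W A i.+1 | v \in e] :|:
    [set e in live W A i | v \notin \bigcup_(u in e :\: W) nbrs W A u].
Proof.
move=> vA vW; apply/subsetP=> e; rewrite !inE => /and3P[eH eA /eqP ei].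
have eE : e :\: (v |: W) = (e :\: W) :\ v by rewrite setUC setDDl.
rewrite eE in eA ei.
have eA' : e :\: W \subset A.
  apply/subsetP=> x xe; have [->//|xv] := eqVneq x v.
  have: x \in (e :\: W) :\ v by rewrite in_setD1 xv.
  by move/(subsetP eA); rewrite inE => /andP[].
have [ve|ve] := boolP (v \in e); [apply/orP; left|apply/orP; right].
  by rewrite eH eA' andbT /= (cardsD1 v) ei inE ve vW.
have veW : v \notin e :\: W by rewrite inE (negPf ve) andbF.
have eDv : (e :\: W) :\ v = e :\: W.
  by apply/setDidPl; rewrite disjoint_sym disjoints1.
rewrite eDv in eA ei; rewrite eH eA' ei eqxx /=.
apply/bigcupP=> -[u ue]; have uA := subsetP eA' u ue; rewrite nbrsC // => uv.
by have := subsetP eA u ue; rewrite in_setD in_setU uv orbT.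
Qed.

(** The left-hand side adds to the residues of size [i] that survive the
    selection of [v], summed over [v], the sum over these residues of the degrees
    of their vertices. A residue survives only if [v] is not adjacent to it, and the
    neighbourhoods of its vertices overlap in at most one point, which costs the
    error [i ^ 2]. *)
Lemma sum_live_select W A i : [disjoint A & W] ->
  \sum_(v in A) #|live (v |: W) (alive_after W A v) i| +
  \sum_(u in A) #|[set e in live W A i | u \in e]| * #|nbrs W A u|
    <= i.+1 * #|live W A i.+1| + #|live W A i| * (#|A| + i ^ 2).
Proof.
move=> AW.
have notW v : v \in A -> v \notin W by move=> vA; rewrite (disjointFr AW).
have sub_live j e : e \in live W A j -> e :\: W \subset A /\ #|e :\: W| = j.
  by rewrite inE => /and3P[_ -> /eqP->].
have inA j e v : e \in live W A j -> (v \in A) && (v \in e) = (v \in e :\: W).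
  move=> /sub_live[eA _]; rewrite inE; apply/andP/andP => -[].
    by move=> vA ->; rewrite notW.
  by move=> vW ve; split=> //; apply: (subsetP eA); rewrite inE vW.
have grow : \sum_(v in A) #|[set e in live W A i.+1 | v \in e]| =
    i.+1 * #|live W A i.+1|.
  under eq_bigr do rewrite -[#|_|]muln1.
  rewrite (sum_card_double_count _ _ (fun v e => v \in e) (fun=> 1)).
  rewrite mulnC -sum_nat_const; apply: eq_bigr => e eL.
  rewrite (eq_bigl (mem (e :\: W))); last by move=> v; rewrite /= (inA _ _ _ eL).
  by rewrite sum1_card; have [_ ->] := sub_live _ _ eL.
pose U e := \bigcup_(u in e :\: W) nbrs W A u.
have keep : \sum_(v in A) #|[set e in live W A i | v \notin U e]| =
    \sum_(e in live W A i) (#|A| - #|U e|).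
  under eq_bigr do rewrite -[#|_|]muln1.
  rewrite (sum_card_double_count _ _ (fun v e => v \notin U e) (fun=> 1)).
  apply: eq_bigr => e eL; rewrite sum1dep_card.
  have UA : U e \subset A by apply/bigcupsP=> u _; apply/subsetP=> x; rewrite inE => /andP[].
  have -> : #|A| - #|U e| = #|A :\: U e| by rewrite cardsD (setIidPr UA).
  by apply: eq_card => v; rewrite inE in_setD andbC.
have hit : \sum_(u in A) #|[set e in live W A i | u \in e]| * #|nbrs W A u| =
    \sum_(e in live W A i) \sum_(u in e :\: W) #|nbrs W A u|.
  rewrite (sum_card_double_count _ _ (fun v e => v \in e)).
  apply: eq_bigr => e eL; apply: eq_bigl => v; exact: inA eL.
have step : \sum_(v in A) #|live (v |: W) (alive_after W A v) i| <=
    i.+1 * #|live W A i.+1| + \sum_(e in live W A i) (#|A| - #|U e|).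
  rewrite -grow -keep -big_split /=; apply: leq_sum => v vA.
  apply: leq_trans (subset_leq_card (live_select_sub i vA (notW _ vA))) _.
  exact: leq_card_setU.
apply: leq_trans (leq_add step (leqnn _)) _; rewrite -addnA leq_add2l hit -big_split /=.
rewrite -sum_nat_const; apply: leq_sum => e eL.
have [eA ei] := sub_live _ _ eL.
have UA : #|U e| <= #|A|.
  by apply/subset_leq_card/bigcupsP=> u _; apply/subsetP=> x; rewrite inE => /andP[].
suff : \sum_(u in e :\: W) #|nbrs W A u| <= #|U e| + i ^ 2 by lia.
rewrite -ei; apply: sum_card_le_bigcup => u1 u2 _ _ u12.
apply: leq_trans (adj_codegree W u12); apply: subset_leq_card.
by apply/subsetP=> v; rewrite !inE !(adjC _ v) => /andP[/andP[_ ->] /andP[_ ->]].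
Qed.

End Residual.

Local Open Scope ring_scope.

(** * The potential *)

Section Potential.
Variables (R : realFieldType) (V : finType) (H : {set {set V}}) (k : nat).
Implicit Types (W A e f g : {set V}) (u v x y z : V) (a : nat -> R).

Hypothesis sizeH : edge_sizes_in 2 k H.
Hypothesis bouqH : bouquet k H.
Hypothesis k_ge2 : (2 <= k)%N.

Definition potential a W A : R :=
  #|A|%:R - \sum_(i < k.+1) a i * #|live H W A i|%:R.

Definition live_deg W A i u := #|[set e in live H W A i | u \in e]|.

(** The second clause says both that [W] is independent (no residue is empty) and
    that adding any single vertex of [A] keeps it so. *)
Definition admissible W A : Prop :=
  [disjoint A & W] /\
  forall e, e \in H -> e :\: W \subset A -> (1 < #|e :\: W|)%N.

Lemma admissible_subset W A (B : {set V}) :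
  B \subset A -> admissible W A -> admissible W B.
Proof.
move=> BA [AW adm]; split; first exact: disjointWl AW.
by move=> e eH eB; apply: adm => //; apply: subset_trans BA.
Qed.

Lemma admissible_independent W A : admissible W A -> independent H W.
Proof.
case=> _ adm; apply/forall_inP => e eH; apply/negP; rewrite -setD_eq0 => /eqP eW.
by have := adm e eH; rewrite eW sub0set cards0 => /(_ isT).
Qed.

Lemma admissible_select W A v : v \in A -> admissible W A ->
  admissible (v |: W) (alive_after H W A v).
Proof.
move=> vA [AW adm]; split.
  rewrite disjoint_sym disjoints_subset; apply/subsetP=> x.
  rewrite !inE => /orP[->//|xW]; have xA : x \notin A by rewrite (disjointFl AW).
  by rewrite (negPf xA) andbF.
move=> e eH; have -> : e :\: (v |: W) = (e :\: W) :\ v by rewrite setUC setDDl.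
move=> eA; have eA' : e :\: W \subset A.
  apply/subsetP=> x xe; have [->//|xv] := eqVneq x v.
  have: x \in (e :\: W) :\ v by rewrite in_setD1 xv.
  by move/(subsetP eA); rewrite inE => /andP[].
have big := adm e eH eA'.
rewrite ltnNge; apply/negP => small.
have ve : v \in e :\: W.
  by apply: contraTT big => ve; move: small; rewrite (cardsD1 v (e :\: W)) (negPf ve) -leqNgt.
have /cards1P[u eu] : #|(e :\: W) :\ v| == 1%N.
  by move: big; rewrite (cardsD1 v) ve ltnS eqn_leq small.
have : u \in (e :\: W) :\ v by rewrite eu inE.
move=> ue; have := subsetP eA u ue; move: ue; rewrite in_setD1 => /andP[uv ueW].
rewrite !inE (negPf uv) /= (subsetP eA' u ueW) /= andbT => /negP[].
by apply/adjP; split=> //; exists e => //; rewrite setUC -eu setD1K.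
Qed.

Lemma sum_live_deg W A i : [disjoint A & W] ->
  (\sum_(u in A) live_deg W A i u)%N = (i * #|live H W A i|)%N.
Proof.
move=> AW; under eq_bigr do rewrite -[live_deg _ _ _ _]muln1.
rewrite (sum_card_double_count _ _ (fun v e => v \in e) (fun=> 1%N)).
rewrite mulnC -sum_nat_const; apply: eq_bigr => e.
rewrite inE => /and3P[_ eA /eqP <-]; rewrite sum1_card; apply: eq_card => v.
rewrite !inE /=; apply/andP/andP => -[].
  by move=> vA ->; rewrite (disjointFr AW).
by move=> vW ve; split=> //; apply: (subsetP eA); rewrite inE vW.
Qed.

(** With [potential_maximal], this turns a bound on weighted degrees into a bound
    on the number of vertices killed by one selection. *)
Lemma card_nbrs_le_deg W A u : [disjoint A & W] -> u \in A ->
  (#|nbrs H W A u| <= live_deg W A 2 u)%N.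
Proof.
move=> AW uA; have uW : u \notin W by rewrite (disjointFr AW).
pose D := [set e in live H W A 2 | u \in e].
have sub : nbrs H W A u \subset \bigcup_(e in D) ((e :\: W) :\ u).
  apply/subsetP=> v; rewrite inE => /andP[vA /adjP[uv [e eH eW]]].
  apply/bigcupP; exists e; last by rewrite eW !inE eqxx andbT.
  rewrite !inE eH eW cards2 uv eqxx andbT (mem_residual2 _ eW) eqxx orbT andbT /=.
  by apply/subsetP=> x; rewrite !inE => /orP[]/eqP->.
apply: leq_trans (subset_leq_card sub) _.
apply: leq_trans (card_bigcup_le _ _) _.
rewrite /live_deg -sum1_card; apply: leq_sum => e; rewrite !inE.
move=> /andP[/and3P[_ eA /eqP e2] ue].
by move: e2; rewrite (cardsD1 u) inE uW ue add1n => -[->].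
Qed.

Lemma card_alive_after W A v : v \in A ->
  (#|alive_after H W A v| + #|nbrs H W A v|).+1 = #|A|.
Proof.
move=> vA; have nv : v \notin nbrs H W A v by rewrite inE /adj eqxx andbF.
have sub : v |: nbrs H W A v \subset A.
  by apply/subsetP=> x; rewrite !inE => /orP[/eqP->|/andP[]].
by rewrite -(cardsID (v |: nbrs H W A v) A) (setIidPr sub) cardsU1 nv addnC add1n.
Qed.

Lemma potential_delete a W A u : [disjoint A & W] -> u \in A ->
  potential a W (A :\ u) = potential a W A - 1 + \sum_(i < k.+1) a i * (live_deg W A i u)%:R.
Proof.
move=> AW uA; have uW : u \notin W by rewrite (disjointFr AW).
have split_live i : #|live H W A i| = (live_deg W A i u + #|live H W (A :\ u) i|)%N.
  rewrite -(cardsID [set e : {set V} | u \in e] (live H W A i)); congr addn.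
    by apply: eq_card => e; rewrite !inE.
  apply: eq_card => e; rewrite !inE subsetD1 inE uW /=.
  by case: (e \in H); case: (u \in e); case: (_ \subset _).
rewrite /potential (cardsD1 u A) uA natrD.
under [X in _ = _ - X - _ + _]eq_bigr do rewrite split_live natrD mulrDr.
by rewrite big_split /=; lra.
Qed.

Lemma potential_maximal a W A : [disjoint A & W] -> exists2 B : {set V},
  B \subset A & potential a W A <= potential a W B /\
    {in B, forall u, \sum_(i < k.+1) a i * (live_deg W B i u)%:R <= 1}.
Proof.
move=> AW; case: (@arg_maxP _ R {set V} A (fun B : {set V} => B \subset A) (potential a W) (subxx A)).
move=> B BA max; exists B => //; split; first exact: max.
move=> u uB; have BW := disjointWl BA AW.
have : potential a W (B :\ u) <= potential a W B.
  exact: (max (B :\ u) (subset_trans (subD1set B u) BA)).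
by rewrite potential_delete //; lra.
Qed.

(** One step of the process. The average of the new potential over [v] is at
    least [1 - kap] times the old one: in the difference of the two, the terms in
    [#|A|] cancel for the common rate of death [x = n * kap - 1], and the last
    hypothesis says that the coefficient of each [e_i] is nonnegative. *)
Lemma potential_select a a' (kap : R) W A : let n : R := #|A|%:R in
    admissible W A ->
    {in A, forall u, \sum_(i < k.+1) a i * (live_deg W A i u)%:R <= 1} ->
    (forall i, 0 <= a i) -> (forall i, 0 <= a' i) ->
    (forall i, (2 <= i <= k)%N -> a i <= a' i) ->
    1 <= a 2 * (n * kap - 1) ->
    (forall i, (2 <= i <= k)%N ->
       i%:R * a i + i%:R * a' i.-1 + k%:R ^+ 2 * a' i <=
       n * ((1 + i.-1%:R * kap) * a i - a' i)) ->
  exists2 v, v \in A &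
    (1 - kap) * potential a W A <= potential a' (v |: W) (alive_after H W A v).
Proof.
move=> n [AW adm] light a0 a'0 le_aa' rate decay.
have n0 : 0 <= n by rewrite ler0n.
(* The common rate of death; 1 is subtracted for the selected vertex itself. *)
pose x := n * kap - 1; pose nb u : R := #|nbrs H W A u|%:R.
pose d i u : R := (live_deg W A i u)%:R; pose l i : R := #|live H W A i|%:R.
have n_gt0 : 0 < n.
  rewrite lt_neqAle n0 andbT; apply/eqP=> n_eq0.
  by move: rate; rewrite -n_eq0 mul0r; have := a0 2; lra.
have d0 i u : 0 <= d i u by rewrite ler0n.
have low i : (i < 2)%N -> l i = 0.
  move=> i2; rewrite /l [live _ _ _ _](_ : _ = set0) ?cards0 //; apply/setP=> e.
  rewrite !inE; apply/negP=> /and3P[eH /(adm e eH) h /eqP E].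
  by move: h; rewrite E ltnNge -ltnS i2.
have low_deg i u : (i < 2)%N -> d i u = 0.
  move=> /low/eqP; rewrite !pnatr_eq0 => /eqP l0; apply/eqP.
  rewrite pnatr_eq0 -leqn0 -[X in (_ <= X)%N]l0.
  by apply: subset_leq_card; apply/subsetP=> e; rewrite inE => /andP[].
have nb_le u : u \in A -> nb u <= x.
  move=> uA; have a2_gt0 : 0 < a 2.
    rewrite lt_neqAle a0 andbT; apply/eqP=> E.
    by move: rate; rewrite -E mul0r; lra.
  apply: le_trans (_ : d 2 u <= _); first by rewrite ler_nat card_nbrs_le_deg.
  rewrite -(ler_pM2l a2_gt0); apply: le_trans rate; apply: le_trans (light u uA).
  have lt2 : (2 < k.+1)%N by [].
  rewrite (bigD1 (Ordinal lt2)) //= lerDl; apply: sumr_ge0 => i _.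
  by apply: mulr_ge0.
pose S := \sum_(v in A) potential a' (v |: W) (alive_after H W A v).
have live_count i : \sum_(v in A) (#|live H (v |: W) (alive_after H W A v) i|%:R : R) +
    \sum_(u in A) d i u * nb u <= i.+1%:R * l i.+1 + l i * (n + i%:R ^+ 2).
  have -> : \sum_(u in A) d i u * nb u =
      (\sum_(u in A) live_deg W A i u * #|nbrs H W A u|)%:R.
    by rewrite natr_sum; apply: eq_bigr => u _; rewrite natrM.
  rewrite /l /n -natr_sum -natrX -!(natrD, natrM) ler_nat.
  exact: (sum_live_select sizeH bouqH i AW).
have S_ge : n ^+ 2 - n - \sum_(u in A) nb u - \sum_(i < k.+1)
    a' i * (i.+1%:R * l i.+1 + l i * (n + i%:R ^+ 2) - \sum_(u in A) d i u * nb u) <= S.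
  rewrite /S sumrB lerB //.
    have -> : n ^+ 2 - n - \sum_(u in A) nb u = \sum_(u in A) (n - 1 - nb u).
      by rewrite !sumrB !sumr_const -[n *+ _]mulr_natr -/n expr2.
    apply: ler_sum => v vA; rewrite /n -(card_alive_after W vA) -addn1 !natrD /nb; lra.
  rewrite exchange_big /=; apply: ler_sum => i _; rewrite -mulr_sumr.
  by apply: ler_wpM2l => //; have := live_count i; lra.
(* The deletion of u is weighed by 1 - sum_i a_i d_i(u), which is nonnegative;
   hence the factor nb u may be raised to x. *)
have kill : \sum_(u in A) nb u * (1 - \sum_(i < k.+1) a' i * d i u) <=
    x * (n - \sum_(i < k.+1) a i * (i%:R * l i)).
  apply: le_trans (_ : \sum_(u in A) x * (1 - \sum_(i < k.+1) a i * d i u) <= _).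
    apply: ler_sum => u uA.
    apply: le_trans (_ : nb u * (1 - \sum_(i < k.+1) a i * d i u) <= _).
      apply: ler_wpM2l; first by rewrite ler0n.
      rewrite lerB //; apply: ler_sum => i _.
      have [/low_deg->|i2] := ltnP i 2; first by rewrite !mulr0.
      by apply: ler_wpM2r => //; apply: le_aa'; rewrite i2 -ltnS ltn_ord.
    by apply: ler_wpM2r; [rewrite subr_ge0 light|exact: nb_le].
  rewrite -mulr_sumr sumrB sumr_const -/n exchange_big /=.
  rewrite le_eqVlt; apply/orP; left; apply/eqP; congr (x * (n - _)).
  apply: eq_bigr => i _; rewrite -mulr_sumr -natrM -(sum_live_deg i AW).
  by rewrite raddf_sum.
have swap : \sum_(i < k.+1) a' i * \sum_(u in A) d i u * nb u =
    \sum_(u in A) nb u * \sum_(i < k.+1) a' i * d i u.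
  under eq_bigr do rewrite mulr_sumr; rewrite exchange_big /=.
  by apply: eq_bigr => u _; rewrite mulr_sumr; apply: eq_bigr => i _; ring.
have shift : \sum_(i < k.+1) a' i * (i.+1%:R * l i.+1) =
    \sum_(i < k.+1) i%:R * a' i.-1 * l i.
  rewrite big_ord_recr big_ord_recl /= [l k.+1](_ : _ = 0); last first.
    rewrite /l [live _ _ _ _](_ : _ = set0) ?cards0 //; apply/setP=> e; rewrite !inE.
    apply/negP=> /and3P[/sizeH/andP[_ ek] _ /eqP ek'].
    by have := leq_trans (subset_leq_card (subsetDl e W)) ek; rewrite ek' ltnn.
  rewrite !mulr0 addr0 !mul0r add0r; apply: eq_bigr => i _.
  by rewrite /bump leq0n add1n add0n mulrCA mulrA.
have gain : 0 <= \sum_(i < k.+1) l i * (n * ((1 + i%:R * kap - kap) * a i - a' i)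
    - i%:R * a i - i%:R * a' i.-1 - i%:R ^+ 2 * a' i).
  apply: sumr_ge0 => i _; have [/low->|i2] := ltnP i 2; first by rewrite mul0r.
  apply: mulr_ge0; first by rewrite ler0n.
  have := decay i; rewrite i2 -ltnS ltn_ord => /(_ isT).
  have -> : (i.-1%:R : R) = i%:R - 1 by rewrite -subn1 natrB // ltnW.
  have : (i%:R ^+ 2 : R) * a' i <= k%:R ^+ 2 * a' i.
    by apply: ler_wpM2r => //; rewrite lerXn2r ?nnegrE ?ler0n // ler_nat -ltnS.
  by nra.
have S_ge' : n * ((1 - kap) * potential a W A) <= S.
  apply: le_trans S_ge.
  have -> : potential a W A = n - \sum_(i < k.+1) a i * l i by [].
  have E1 : \sum_(u in A) nb u * (1 - \sum_(i < k.+1) a' i * d i u) =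
      \sum_(u in A) nb u - \sum_(u in A) nb u * \sum_(i < k.+1) a' i * d i u.
    by rewrite -sumrB; apply: eq_bigr => u _; ring.
  move: kill; rewrite E1 -swap => kill.
  have -> : \sum_(i < k.+1) a' i * (i.+1%:R * l i.+1 + l i * (n + i%:R ^+ 2)
       - \sum_(u in A) d i u * nb u) =
    \sum_(i < k.+1) i%:R * a' i.-1 * l i + \sum_(i < k.+1) a' i * (l i * (n + i%:R ^+ 2))
     - \sum_(i < k.+1) a' i * \sum_(u in A) d i u * nb u.
    by rewrite -shift -big_split -sumrB /=; apply: eq_bigr => i _; ring.
  have : 0 <= x * \sum_(i < k.+1) a i * (i%:R * l i) + n * (1 - kap) * \sum_(i < k.+1) a i * l i
     - \sum_(i < k.+1) i%:R * a' i.-1 * l i - \sum_(i < k.+1) a' i * (l i * (n + i%:R ^+ 2)).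
    apply: le_trans gain _; rewrite !mulr_sumr -big_split -!sumrB /=.
    by apply: ler_sum => i _; rewrite /x; nra.
  move: kill; rewrite /x; nra.
apply/exists_inP; apply: contraTT isT => none.
have : S < n * ((1 - kap) * potential a W A).
  rewrite /n mulr_natl -sumr_const; apply: ltr_sum => [|v vA].
    by move: n_gt0; rewrite ltr0n => /card_gt0P[v vA]; apply/hasP; exists v; rewrite ?mem_index_enum.
  rewrite ltNge; apply: contraNN none => h; apply/exists_inP; by exists v.
by rewrite ltNge S_ge'.
Qed.

End Potential.

(** * The schedule of the weights *)

Lemma bernoulli_ge (R : realFieldType) (x : R) (t : nat) :
  0 <= x <= 1 -> 1 - t%:R * x <= (1 - x) ^+ t.
Proof.
move=> /andP[x0 x1]; elim: t => [|t IH]; first by rewrite mul0r subr0 expr0.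
rewrite exprS; apply: le_trans (_ : (1 - x) * (1 - t%:R * x) <= _); last first.
  by apply: ler_wpM2l => //; rewrite subr_ge0.
have : 0 <= t%:R * x * x by rewrite !mulr_ge0 ?ler0n.
by rewrite -natr1; nra.
Qed.

Section Schedule.
Variables (R : realFieldType) (k J : nat) (N kap tau : R) (b : nat -> R).

Hypothesis k_ge2 : (2 <= k)%N.
Hypothesis b_gt0 : forall i, 0 < b i.
Hypothesis kap_gt0 : 0 < kap.
Hypothesis kap_small : k%:R * kap <= 1.
Hypothesis kap_long : 1 <= kap * J%:R.
Hypothesis kap2_small : 2 * k%:R * kap ^+ 2 * J%:R <= 1.
Hypothesis b_ratio : forall i, (2 <= i <= k)%N -> b i.-1 <= tau * b i.
Hypothesis tau_J : 32 * k%:R * J%:R * tau <= N.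
Hypothesis b2_rate : 8 <= kap * N * b 2.
Hypothesis b2_small : 2 * b 2 * (1 + kap) ^+ J <= 1.
Hypothesis N_large : 64 * k%:R ^+ 2 * J%:R * (1 + kap) ^+ J <= N.

(** The power grows like [q ^ (1 - i)] for the surviving fraction
    [q = (1 - kap) ^ t]; writing it as a power of [1 + i.-1%:R * kap] makes the
    growth over one step match [potential_select] exactly. The factor between 2
    and 1 pays for the residues that shrink. *)
Definition weight t i : R :=
  b i * (2 - t%:R / J%:R) * (1 + i.-1%:R * kap) ^+ t.

Lemma weight_ge0 t i : (t <= J)%N -> 0 <= weight t i.
Proof.
move=> tJ; rewrite /weight !mulr_ge0 ?(ltW (b_gt0 i)) //.
  have : t%:R / J%:R <= 1 :> R.
    have [->|J_gt0] := posnP J; first by rewrite invr0 mulr0.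
    by rewrite ler_pdivrMr ?ltr0n // mul1r ler_nat.
  by lra.
by rewrite exprn_ge0 // addr_ge0 // mulr_ge0 ?ler0n // ltW.
Qed.

Variables (t : nat).
Hypothesis tJ : (t < J)%N.

Let J_gt0 : 0 < J%:R :> R.
Proof. by rewrite ltr0n (leq_trans _ tJ). Qed.

Let k_ge2R : 2 <= k%:R :> R.
Proof. by rewrite ler_nat. Qed.

Let g i : R := (1 + i.-1%:R * kap) ^+ t.

Let g_gt0 i : 0 < g i.
Proof. by rewrite exprn_gt0 // ltr_pwDl // mulr_ge0 ?ler0n // ltW. Qed.

Let slack : 1 <= 2 - t.+1%:R / J%:R :> R.
Proof.
have : t.+1%:R / J%:R <= 1 :> R by rewrite ler_pdivrMr // mul1r ler_nat.
lra.
Qed.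

Let slackS : 2 - t%:R / J%:R = 2 - t.+1%:R / J%:R + J%:R^-1 :> R.
Proof. by rewrite -natr1; field; rewrite gt_eqF. Qed.

Let t_ge0 : 0 <= t%:R / J%:R :> R.
Proof. by rewrite divr_ge0 ?ler0n. Qed.

Let growth i : (2 <= i <= k)%N -> kap <= i.-1%:R * kap <= 1.
Proof.
move=> /andP[i2 ik]; apply/andP; split.
  rewrite -[X in X <= _]mul1r; apply: ler_wpM2r; first exact: ltW.
  by rewrite ler1n; case: i i2 {ik} => [|[]].
apply: le_trans kap_small; apply: ler_wpM2r; first exact: ltW.
by rewrite ler_nat (leq_trans (leq_pred i)).
Qed.

Lemma weightS i : weight t.+1 i =
  b i * (2 - t.+1%:R / J%:R) * (1 + i.-1%:R * kap) * g i.
Proof. by rewrite /weight exprS !mulrA. Qed.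

Lemma weight_le i : (2 <= i <= k)%N -> weight t i <= weight t.+1 i.
Proof.
move=> ik; rewrite weightS /weight -/(g i).
apply: ler_wpM2r; first exact: ltW.
rewrite -mulrA; apply: ler_wpM2l; first exact: ltW.
have /andP[k1 k2] := growth ik.
have Jk : J%:R^-1 <= kap by rewrite -[X in X <= _]mul1r ler_pdivrMr.
have := slack; rewrite slackS; set s := 2 - _ => s1.
have : 0 <= (s - 1) * (i.-1%:R * kap) by rewrite mulr_ge0 ?subr_ge0 // (le_trans (ltW kap_gt0) k1).
nra.
Qed.

Let tkap2 : t%:R * (k%:R * kap ^+ 2) <= 1 / 2.
Proof.
have : t%:R * (k%:R * kap ^+ 2) <= J%:R * (k%:R * kap ^+ 2).
  by apply: ler_wpM2r; [rewrite mulr_ge0 ?ler0n ?sqr_ge0|rewrite ler_nat ltnW].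
by move: kap2_small; nra.
Qed.

Let kap_half : kap <= 1 / 2.
Proof.
have : 2 * kap <= k%:R * kap by apply: ler_wpM2r => //; exact: ltW.
by move: kap_small; lra.
Qed.

Let kkap2 : 0 <= k%:R * kap ^+ 2 <= 1 / 2.
Proof.
rewrite mulr_ge0 ?ler0n ?sqr_ge0 //=; apply: le_trans kap_half.
by rewrite expr2 mulrA -[X in _ <= X]mul1r; apply: ler_wpM2r => //; exact: ltW.
Qed.

(* Bounds the accumulated second-order error of replacing (1 - kap) by the
   inverse of (1 + kap). *)
Let half_le : 1 / 2 <= (1 - k%:R * kap ^+ 2) ^+ t.
Proof.
apply: le_trans (bernoulli_ge t _); first by move: tkap2; lra.
by have /andP[-> h] := kkap2; apply: le_trans h _; lra.
Qed.

Variable n : R.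
Hypothesis n_large : (1 - kap) ^+ t * (N / 2) <= n.

Let N_ge0 : 0 <= N.
Proof.
apply: le_trans N_large; rewrite !mulr_ge0 ?ler0n ?sqr_ge0 // exprn_ge0 //.
by move: kap_gt0; lra.
Qed.

(* The number of alive vertices makes up for one power of the growth. *)
Let n_g i : (2 <= i <= k)%N -> N / 4 * (1 + i.-2%:R * kap) ^+ t <= n * g i.
Proof.
move=> ik; have /andP[k1 k2] := growth ik.
apply: le_trans (_ : (1 - kap) ^+ t * (N / 2) * g i <= _); last first.
  by apply: ler_wpM2r => //; exact: ltW.
set h := 1 + _; have h_ge1 : 1 <= h by rewrite lerDl mulr_ge0 ?ler0n // ltW.
have E : 1 + i.-1%:R * kap = h + kap.
  rewrite /h; case: i ik {k1 k2 h h_ge1} => [|[|i]] //= _; rewrite -natr1; ring.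
have le_i : i.-1%:R <= k%:R :> R.
  by rewrite ler_nat (leq_trans (leq_pred i)) //; case/andP: ik.
rewrite [X in _ <= X]mulrAC /g -exprMn E.
apply: le_trans (_ : (h * (1 - k%:R * kap ^+ 2)) ^+ t * (N / 2) <= _); last first.
  apply: ler_wpM2r; first by move: N_ge0; lra.
  apply: lerXn2r; rewrite ?nnegrE.
  - apply: mulr_ge0; first lra.
    by move: kkap2 => /andP[_ kk]; lra.
  - apply: mulr_ge0; first by move: kap_half; lra.
    by move: kap_gt0; lra.
  have : i.-1%:R * kap ^+ 2 <= k%:R * kap ^+ 2 by apply: ler_wpM2r; rewrite ?sqr_ge0.
  have : 0 <= (h - 1) * (k%:R * kap ^+ 2).
    by rewrite mulr_ge0 ?subr_ge0 // mulr_ge0 ?ler0n ?sqr_ge0.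
  by move: E; nra.
rewrite exprMn.
have := half_le; set z := (1 - _) ^+ t => z2.
have : 0 <= h ^+ t * N * (z - 1 / 2).
  by rewrite !mulr_ge0 ?subr_ge0 // exprn_ge0 //; lra.
lra.
Qed.

Let n_J : 16 * k%:R ^+ 2 * J%:R <= n.
Proof.
have kk : (2 <= 2 <= k)%N by [].
have G := n_g kk; rewrite /= mul0r addr0 expr1n mulr1 in G.
have g_le : g 2 <= (1 + kap) ^+ J.
  by rewrite /g /= mul1r; apply: ler_weXn2l; [move: kap_gt0; lra|exact: ltnW].
have g1 : 0 < g 2 := g_gt0 2.
rewrite -(ler_pM2r g1); apply: le_trans G.
apply: le_trans (_ : 16 * k%:R ^+ 2 * J%:R * (1 + kap) ^+ J <= _); last first.
  by move: N_large; lra.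
by apply: ler_wpM2l => //; rewrite !mulr_ge0 ?ler0n ?sqr_ge0.
Qed.

Lemma weight_rate : 1 <= weight t 2 * (n * kap - 1).
Proof.
have kk : (2 <= 2 <= k)%N by [].
have G := n_g kk; rewrite /= mul0r addr0 expr1n mulr1 in G.
have P_le : (1 + kap) ^+ t <= (1 + kap) ^+ J.
  by apply: ler_weXn2l; [move: kap_gt0; lra|exact: ltnW].
have g2E : g 2 = (1 + kap) ^+ t by rewrite /g /= mul1r.
have w_eq : weight t 2 = b 2 * (2 - t%:R / J%:R) * g 2 by [].
have b2 := b_gt0 2; have g2 := g_gt0 2.
have w_le : weight t 2 <= 2 * b 2 * g 2.
  rewrite w_eq; apply: ler_wpM2r; first exact: ltW.
  by rewrite mulrC; apply: ler_wpM2r; [exact: ltW|move: t_ge0; lra].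
have w_le1 : 2 * b 2 * g 2 <= 1.
  apply: le_trans b2_small; rewrite g2E; apply: ler_wpM2l => //.
  by rewrite mulr_ge0 // ltW.
have w_ge : b 2 * g 2 <= weight t 2.
  rewrite w_eq; apply: ler_wpM2r; first exact: ltW.
  rewrite -[X in X <= _]mulr1; apply: ler_wpM2l; first exact: ltW.
  have Ji : 0 <= J%:R^-1 :> R by rewrite invr_ge0 ler0n.
  by rewrite slackS; move: slack; lra.
have n_ge0 : 0 <= n.
  by apply: le_trans n_J; rewrite !mulr_ge0 ?ler0n ?sqr_ge0.
have main : 2 <= kap * (n * weight t 2).
  apply: le_trans (_ : kap * (n * (b 2 * g 2)) <= _); last first.
    apply: ler_wpM2l; first exact: ltW.
    exact: ler_wpM2l.
  apply: le_trans (_ : kap * (b 2 * (N / 4)) <= _); first by move: b2_rate; lra.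
  apply: ler_wpM2l; first exact: ltW.
  by rewrite [X in _ <= X]mulrCA; apply: ler_wpM2l => //; exact: ltW.
by move: main w_le w_le1; lra.
Qed.

(** In one step the factor between 2 and 1 drops by [1 / J]. One half of this drop
    pays for the overlap errors, because [n] exceeds [J] by far; the other half
    pays for the residues of size [i] that shrink and from then on count with
    the larger weight [a_(i - 1)]. *)
Lemma weight_decay i : (2 <= i <= k)%N ->
  i%:R * weight t i + i%:R * weight t.+1 i.-1 + k%:R ^+ 2 * weight t.+1 i <=
  n * ((1 + i.-1%:R * kap) * weight t i - weight t.+1 i).
Proof.
move=> ik; have /andP[k1 k2] := growth ik; have bi := b_gt0 i; have gi := g_gt0 i.
have ikR : i%:R <= k%:R :> R by rewrite ler_nat; case/andP: ik.
have n_ge0 : 0 <= n by apply: le_trans n_J; rewrite !mulr_ge0 ?ler0n ?sqr_ge0.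
have k0 : 0 <= k%:R :> R by rewrite ler0n.
have s'1 := slack; have t0 : 0 <= t.+1%:R / J%:R :> R by rewrite divr_ge0 ?ler0n.
set s' := 2 - t.+1%:R / J%:R in s'1; have s'2 : s' <= 2 by rewrite /s'; lra.
pose B := b i * g i; have B0 : 0 < B by rewrite mulr_gt0.
have own : weight t i <= 2 * B.
  have -> : weight t i = (2 - t%:R / J%:R) * B.
    by rewrite /weight -/(g i) /B; ring.
  by apply: ler_wpM2r; [exact: ltW|move: t_ge0; lra].
have ownS : weight t.+1 i <= 4 * B.
  have -> : weight t.+1 i = (s' * (1 + i.-1%:R * kap)) * B.
    by rewrite weightS -/s' /B; ring.
  by apply: ler_wpM2r; [exact: ltW|nra].
pose h := (1 + i.-2%:R * kap) ^+ t.
have h0 : 0 <= h by rewrite exprn_ge0 // addr_ge0 // mulr_ge0 ?ler0n // ltW.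
have downS : weight t.+1 i.-1 <= 4 * tau * b i * h.
  rewrite weightS -/s' /g -/h; apply: ler_wpM2r => //.
  have i2 : i.-2%:R * kap <= 1.
    apply: le_trans kap_small; apply: ler_wpM2r; first exact: ltW.
    by apply: le_trans ikR; rewrite ler_nat -subn2 leq_subr.
  have i20 : 0 <= i.-2%:R * kap by rewrite mulr_ge0 ?ler0n // ltW.
  apply: le_trans (_ : b i.-1 * 4 <= _).
    by rewrite -mulrA; apply: ler_wpM2l; [exact: ltW|nra].
  by have := b_ratio ik; lra.
have gap : (1 + i.-1%:R * kap) * weight t i - weight t.+1 i =
    (1 + i.-1%:R * kap) / J%:R * B.
  by rewrite weightS /weight -/(g i) slackS /B; ring.
rewrite gap.
have n1 : n * (B / J%:R) <= n * ((1 + i.-1%:R * kap) / J%:R * B).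
  apply: ler_wpM2l => //.
  have -> : (1 + i.-1%:R * kap) / J%:R * B = (1 + i.-1%:R * kap) * (B / J%:R) by ring.
  rewrite -[X in X <= _]mul1r.
  apply: ler_wpM2r.
    by rewrite divr_ge0 ?ler0n // ltW.
  by move: kap_gt0; lra.
apply: le_trans n1.
have half1 : i%:R * weight t i + k%:R ^+ 2 * weight t.+1 i <= n * (B / J%:R) / 2.
  apply: le_trans (_ : 8 * k%:R ^+ 2 * B <= _).
    apply: le_trans (_ : k%:R * (2 * B) + k%:R ^+ 2 * (4 * B) <= _).
      apply: lerD; last by apply: ler_wpM2l; rewrite ?sqr_ge0.
      by apply: ler_pM; rewrite ?ler0n // weight_ge0 // ltnW.
    have : 0 <= k%:R * (k%:R - 2) * B :> R.
      by rewrite !mulr_ge0 ?subr_ge0 // ltW.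
    nra.
  have -> : n * (B / J%:R) / 2 = (n / (2 * J%:R)) * B by field; rewrite gt_eqF.
  apply: ler_wpM2r; first exact: ltW.
  rewrite ler_pdivlMr ?mulr_gt0 //; apply: le_trans n_J; lra.
have half2 : i%:R * weight t.+1 i.-1 <= n * (B / J%:R) / 2.
  apply: le_trans (_ : k%:R * (4 * tau * b i * h) <= _).
    apply: le_trans (_ : i%:R * (4 * tau * b i * h) <= _).
      by apply: ler_wpM2l; rewrite ?ler0n.
    apply: ler_wpM2r => //; rewrite !mulr_ge0 // ltW //.
    by rewrite -(pmulr_lgt0 _ bi); apply: lt_le_trans (b_ratio ik).
  have -> : n * (B / J%:R) / 2 = (n * g i) * (b i / (2 * J%:R)).
    by rewrite /B; field; rewrite gt_eqF.
  apply: le_trans (_ : N / 4 * h * (b i / (2 * J%:R)) <= _); last first.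
    apply: ler_wpM2r; last exact: n_g.
    by rewrite divr_ge0 ?mulr_ge0 ?ler0n // ltW.
  have -> : N / 4 * h * (b i / (2 * J%:R)) = (N / (8 * J%:R)) * (b i * h).
    by field; rewrite gt_eqF.
  have -> : k%:R * (4 * tau * b i * h) = (4 * k%:R * tau) * (b i * h) by ring.
  apply: ler_wpM2r; first by rewrite mulr_ge0 // ltW.
  by rewrite ler_pdivlMr ?mulr_gt0 //; move: tau_J; lra.
by move: half1 half2; lra.
Qed.

End Schedule.

(** * Selecting many vertices *)

(** Here [kap] is the fraction of the vertices lost per step, and [tau] bounds the
    ratio of consecutive initial weights. The invariant is that after [t] steps
    the potential is at least [(1 - kap) ^ t * (N / 2)]. *)
Lemma alpha_ge_schedule (R : realFieldType) (V : finType) (H : {set {set V}})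
    (k J : nat) (kap tau : R) (b : nat -> R) : let N : R := #|V|%:R in
    edge_sizes_in 2 k H -> bouquet k H -> (2 <= k)%N ->
    (forall i, 0 < b i) -> 0 < kap -> k%:R * kap <= 1 -> 1 <= kap * J%:R ->
    2 * k%:R * kap ^+ 2 * J%:R <= 1 ->
    (forall i, (2 <= i <= k)%N -> b i.-1 <= tau * b i) ->
    32 * k%:R * J%:R * tau <= N ->
    8 <= kap * N * b 2 -> 2 * b 2 * (1 + kap) ^+ J <= 1 ->
    64 * k%:R ^+ 2 * J%:R * (1 + kap) ^+ J <= N ->
    \sum_(i < k.+1) 2 * b i * #|layer H i|%:R <= N / 2 ->
  (J <= alpha H)%N.
Proof.
move=> N sizeH bouqH k_ge2 b_gt0 kap_gt0 kap_small kap_long kap2 b_ratio tau_J b2_rate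
  b2_small N_large start.
suff inv t : (t <= J)%N -> exists (W A : {set V}), [/\ #|W| = t, admissible H W A &
    (1 - kap) ^+ t * (N / 2) <= potential H k (weight J kap b t) W A].
  have [W [A [<- adm _]]] := inv J (leqnn J).
  by apply: leq_bigmax_cond; apply: admissible_independent adm.
elim: t => [_|t IH tJ].
  exists set0, setT; split; first exact: cards0.
    by split=> [|e eH _]; rewrite ?disjoints_subset ?setC0 // setD0; case/andP: (sizeH e eH).
  rewrite expr0 mul1r /potential cardsT -/N.
  suff : \sum_(i < k.+1) weight J kap b 0 i * #|live H set0 [set: V] i|%:R <= N / 2 by lra.
  apply: le_trans start; apply: ler_sum => i _.
  rewrite /weight mul0r subr0 expr0 mulr1 [b i * 2]mulrC.
  rewrite [live _ _ _ _](_ : _ = layer H i) //; apply/setP=> e.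
  by rewrite !inE setD0 subsetT.
have [W [A [cardW adm potA]]] := IH (ltnW tJ).
have [B BA [potB light]] := potential_maximal H k (weight J kap b t) (proj1 adm).
have admB := admissible_subset BA adm.
have w_ge0 i : 0 <= weight J kap b t i by rewrite weight_ge0 // ltnW.
have n_large : (1 - kap) ^+ t * (N / 2) <= #|B|%:R.
  apply: le_trans potA (le_trans potB _); rewrite /potential gerBl; apply: sumr_ge0 => i _.
  by rewrite mulr_ge0 ?ler0n.
have w'_ge0 i : 0 <= weight J kap b t.+1 i by rewrite weight_ge0.
have [v vB pot_v] := potential_select sizeH bouqH k_ge2 admB light w_ge0 w'_ge0
  (weight_le b_gt0 kap_gt0 kap_small kap_long tJ)
  (weight_rate k_ge2 b_gt0 kap_gt0 kap_small kap2 b2_rate b2_small N_large tJ n_large)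
  (weight_decay k_ge2 b_gt0 kap_gt0 kap_small kap2 b_ratio tau_J N_large tJ n_large).
exists (v |: W), (alive_after H W B v); split.
- by rewrite cardsU1 (disjointFr (proj1 admB) vB) cardW.
- exact: admissible_select.
apply: le_trans pot_v; rewrite exprS -mulrA; apply: ler_wpM2l.
  by have : 2 * kap <= k%:R * kap; [apply: ler_wpM2r; rewrite ?ler_nat // ltW | lra].
exact: le_trans potA potB.
Qed.

(** * Choice of the parameters *)

Lemma layer_card_le (V : finType) (H : {set {set V}}) (i : nat) :
  (i * #|layer H i| <= #|V| * max_codegree 1 (layer H i))%N.
Proof.
have -> : layer H i = live H set0 setT i.
  by apply/setP=> e; rewrite !inE setD0 subsetT.
rewrite -sum_live_deg; last by rewrite disjoint_sym disjoints_subset sub0set.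
rewrite -cardsT -sum_nat_const; apply: leq_sum => v _.
rewrite /max_codegree (bigD1 [set v]) ?cards1 //=.
apply: leq_trans (leq_maxl _ _); apply: subset_leq_card.
by apply/subsetP=> e; rewrite !inE sub1set.
Qed.

Lemma expR_half_ge (R : realType) (K L : R) : 16 * K <= L -> 0 <= L -> K * L <= expR (L / 2).
Proof.
move=> KL L0.
have -> : L / 2 = L / 4 + L / 4 by field.
rewrite expRD; have E := expR_ge1Dx (L / 4).
have : (L / 4) * (L / 4) <= expR (L / 4) * expR (L / 4).
  by apply: ler_pM => //; lra.
have : 0 <= (L - 16 * K) * L by rewrite mulr_ge0 // subr_ge0.
lra.
Qed.

(** In terms of [L = ln T] the numerical conditions follow from [2 k L] being at
    most [exp (L / 2)], the square root of [T], and from [N] being at least a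
    fixed power of [T]. *)
Lemma alpha_ge_expR (R : realType) (V : finType) (H : {set {set V}}) (k : nat)
    (L s : R) : let N : R := #|V|%:R in let T := expR L in
    edge_sizes_in 2 k H -> bouquet k H -> (2 <= k)%N ->
    32 * k%:R <= L -> 1 <= s -> s ^+ k.-1 = L -> T ^+ 8 <= N ->
    (forall i, (2 <= i <= k)%N ->
       i%:R * #|layer H i|%:R <= N * (T ^+ i.-1 * s ^+ (k - i))) ->
  (64 * k%:R)^-1 * (N / T) * s <= (alpha H)%:R.
Proof.
move=> N T sizeH bouqH k_ge2 L_large s1 sL T8 layers.
have k2 : 2 <= k%:R :> R by rewrite ler_nat.
have T0 : 0 < T by exact: expR_gt0.
have s0 : 0 < s by apply: lt_le_trans s1.
have L0 : 0 < L by lra.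
pose r := expR (L / 2); have rr : r * r = T.
  by rewrite /r -expRD /T; congr expR; field.
have r0 : 0 < r by exact: expR_gt0.
have kLr : 2 * k%:R * L <= r by apply: expR_half_ge; lra.
have r_large : 256 <= r.
  apply: le_trans kLr; have : 2 * 2 * 64 <= 2 * k%:R * L.
    by rewrite -!mulrA; apply: ler_pM => //; [lra|apply: ler_pM; lra].
  lra.
have rT : r <= T by rewrite -rr -[X in X <= _]mul1r; apply: ler_wpM2r; lra.
have T_N : T ^+ 2 * T ^+ 2 <= N.
  apply: le_trans T8; rewrite -exprD; apply: ler_weXn2l => //; lra.
have N0 : 0 < N by apply: lt_le_trans T8; exact: exprn_gt0.
pose u := s ^+ (k - 2).
have u1 : 1 <= u by exact: exprn_ege1.
have u0 : 0 < u by lra.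
have us : s * u = L by rewrite /u -exprS -sL -subSn // subSS subn1.
have s_le : s <= L by rewrite -us -[X in X <= _]mulr1; apply: ler_wpM2l; lra.
have u_le : u <= L by rewrite -us -[X in X <= _]mul1r; apply: ler_wpM2r; lra.
have k0 : 0 < k%:R :> R by lra.
pose x := s * N / (32 * k%:R * T).
have x0 : 0 <= x by rewrite divr_ge0 ?mulr_ge0 // ltW.
pose J := Num.truncn x.
have /andP[Jx xJ] : (J%:R <= x) && (x < J.+1%:R) by exact: truncn_itv.
rewrite -natr1 in xJ.
(* The value of kap solves kap * N * b 2 = 8, and then J * kap <= L / 2. *)
pose kap := 16 * k%:R * T * u / N.
pose b i := (2 * k%:R * T ^+ i.-1 * s ^+ (k - i))^-1.
pose tau := T / s.
have kap0 : 0 < kap by rewrite divr_gt0 ?mulr_gt0.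
have b_gt0 i : 0 < b i by rewrite invr_gt0 !mulr_gt0 ?exprn_gt0.
have tau0 : 0 <= tau by apply: divr_ge0; exact: ltW.
have kap_x : kap * x = L / 2.
  by rewrite /kap /x -us; field; rewrite !gt_eqF.
have kLT : (2 * k%:R * L) * (2 * k%:R * L) <= T.
  by rewrite -rr; apply: ler_pM => //; rewrite !mulr_ge0 // ltW.
have kapL : k%:R * kap * L <= 1.
  have -> : k%:R * kap * L = (16 * k%:R ^+ 2 * T * u * L) / N by rewrite /kap; ring.
  rewrite ler_pdivrMr // mul1r; apply: le_trans T_N.
  apply: le_trans (_ : 4 * T * ((2 * k%:R * L) * (2 * k%:R * L)) <= _).
    have -> : 16 * k%:R ^+ 2 * T * u * L = (16 * k%:R ^+ 2 * T * L) * u by ring.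
    have -> : 4 * T * (2 * k%:R * L * (2 * k%:R * L)) = (16 * k%:R ^+ 2 * T * L) * L by ring.
    by apply: ler_wpM2l => //; rewrite !mulr_ge0 // ltW.
  apply: le_trans (_ : 4 * T * T <= _).
    by apply: ler_wpM2l => //; rewrite mulr_ge0 // ltW.
  have -> : 4 * T * T = 4 * T ^+ 2 by ring.
  apply: ler_wpM2r; first by rewrite exprn_ge0 // ltW.
  rewrite expr2; have : 4 * 1 <= T * T by apply: ler_pM; lra.
  lra.
have kap_k : k%:R * kap <= 1.
  apply: le_trans kapL; rewrite -[X in X <= _]mulr1; apply: ler_wpM2l; last lra.
  by rewrite mulr_ge0 // ltW.
have kap1 : kap <= 1.
  apply: le_trans kap_k; rewrite -[X in X <= _]mul1r; apply: ler_wpM2r; lra.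
have kapJ : kap * J%:R <= L / 2.
  by rewrite -kap_x; apply: ler_wpM2l => //; exact: ltW.
have powJ : (1 + kap) ^+ J <= r.
  apply: le_trans (_ : expR (kap * J%:R) <= _); last by rewrite ler_expR.
  rewrite expRM_natr; apply: lerXn2r; rewrite ?nnegrE ?expR_ge0 ?expR_ge1Dx //; lra.
have b2E : b 2%N = (2 * k%:R * T * u)^-1 by rewrite /b expr1.
have J_le : (J <= alpha H)%N.
  apply: (@alpha_ge_schedule R V H k J kap tau b) => //.
  - have : kap * (x - 1) <= kap * J%:R by apply: ler_wpM2l; [exact: ltW|lra].
    by rewrite mulrBr kap_x; lra.
  - have : k%:R * kap * (kap * J%:R) <= k%:R * kap * (L / 2).
      by apply: ler_wpM2l => //; rewrite mulr_ge0 // ltW.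
    by move: kapL; rewrite expr2; lra.
  - move=> [|[|i]] //= ik; rewrite le_eqVlt; apply/orP; left; apply/eqP.
    rewrite /b /tau /= [T ^+ i.+1]exprSr.
    have -> : s ^+ (k - i.+1) = s ^+ (k - i.+2) * s by rewrite -exprSr -subSn.
    by field; rewrite !gt_eqF ?exprn_gt0.
  - have -> : 32 * k%:R * J%:R * tau = J%:R * (32 * k%:R * tau) by ring.
    apply: le_trans (_ : x * (32 * k%:R * tau) <= _).
      apply: ler_wpM2r => //; apply: mulr_ge0 tau0.
      by rewrite mulr_ge0 ?ler0n.
    rewrite le_eqVlt; apply/orP; left; apply/eqP; rewrite /x /tau.
    by field; rewrite !gt_eqF.
  - rewrite le_eqVlt; apply/orP; left; apply/eqP; rewrite b2E /kap -/N.
    by field; rewrite !gt_eqF.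
  - apply: le_trans (_ : 2 * b 2%N * r <= _).
      by apply: ler_wpM2l => //; rewrite mulr_ge0 // b2E invr_ge0 !mulr_ge0 // ltW.
    have -> : 2 * b 2%N * r = r / (k%:R * T * u) by rewrite b2E; field; rewrite !gt_eqF.
    rewrite ler_pdivrMr ?mulr_gt0 // mul1r; apply: le_trans rT _.
    have : 1 * 1 <= k%:R * u by apply: ler_pM; lra.
    rewrite mulr1 mulrAC => ku; rewrite -[X in X <= _]mul1r.
    by apply: ler_wpM2r => //; exact: ltW.
  - apply: le_trans (_ : 64 * k%:R ^+ 2 * x * r <= _).
      apply: ler_pM => //; first by rewrite !mulr_ge0 ?exprn_ge0 ?ler0n.
        by rewrite exprn_ge0 //; lra.
      by apply: ler_wpM2l => //; rewrite mulr_ge0 // exprn_ge0 // ltW.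
    have -> : 64 * k%:R ^+ 2 * x * r = (2 * k%:R * s / r) * N.
      by rewrite /x -rr; field; rewrite !gt_eqF.
    rewrite -[X in _ <= X]mul1r; apply: ler_wpM2r; first exact: ltW.
    rewrite ler_pdivrMr // mul1r; apply: le_trans kLr; apply: ler_wpM2l => //.
    by rewrite mulr_ge0 // ltW.
  - apply: le_trans (_ : \sum_(i < k.+1) (if (i : nat) == 0%N then 0 else N / (2 * k%:R)) <= _).
      apply: ler_sum => i _.
      have [i2|i2] := ltnP i 2.
        rewrite (_ : #|layer H i| = 0%N); last first.
          apply/eqP; rewrite cards_eq0; apply/eqP/setP=> e; rewrite !inE.
          apply/negP=> /andP[/sizeH/andP[e2 _] /eqP E].
          by move: e2; rewrite E leqNgt i2.
        by rewrite mulr0; case: ifP => // _; rewrite divr_ge0 ?mulr_ge0 // ltW.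
      rewrite ifN; last by rewrite -lt0n (leq_trans _ i2).
      have ik : (2 <= i <= k)%N by rewrite i2 -ltnS ltn_ord.
      pose p := T ^+ i.-1 * s ^+ (k - i).
      have p0 : 0 < p by rewrite mulr_gt0 ?exprn_gt0.
      have bE : b i = (2 * k%:R * p)^-1 by rewrite /b /p !mulrA.
      have -> : N / (2 * k%:R) = b i * (N * p) by rewrite bE; field; rewrite !gt_eqF.
      rewrite [2 * b i]mulrC -mulrA; apply: ler_wpM2l.
        exact: ltW.
      by apply: le_trans (layers i ik); apply: ler_wpM2r => //; rewrite ler_nat.
    rewrite big_ord_recl /= add0r sumr_const card_ord -mulr_natl.
    rewrite le_eqVlt; apply/orP; left; apply/eqP; by field; rewrite gt_eqF.
apply: le_trans (_ : J%:R <= _); last by rewrite ler_nat.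
have x2 : 2 <= x.
  rewrite /x ler_pdivlMr ?mulr_gt0 //.
  apply: le_trans (_ : 1 * N <= _); last by apply: ler_wpM2r; lra.
  rewrite mul1r; apply: le_trans T_N.
  have kT : 64 * k%:R <= T.
    apply: le_trans rT; apply: le_trans kLr.
    have : 0 <= k%:R * (L - 32) by rewrite mulr_ge0 //; lra.
    lra.
  have -> : 2 * (32 * k%:R * T) = 64 * k%:R * T by ring.
  apply: le_trans (_ : T * T <= _).
    by apply: ler_wpM2r => //; exact: ltW.
  rewrite -expr2 -[X in X <= _]mul1r; apply: ler_wpM2r; first by rewrite exprn_ge0 // ltW.
  by apply: exprn_ege1; lra.
have -> : (64 * k%:R)^-1 * (N / T) * s = x / 2 by rewrite /x; field; rewrite !gt_eqF.
lra.
Qed.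

Theorem theorem1p9 (R : realType) (k : nat) (hk : (2 <= k)%N) :
  exists (c : R) (N0 : nat), 0 < c /\
    forall (N T : nat), (0 < N)%N -> (N0 <= N)%N -> (0 < T)%N ->
      ln (N%:R : R) ^+ 3 <= T%:R ->
      T%:R <= (N%:R : R) `^ (1 / (4 * k%:R)) ->
    forall (V : finType) (H : {set {set V}}),
      #|V| = N ->
      edge_sizes_in 2 k H ->
      bouquet k H ->
      (forall i : nat, (2 <= i <= k)%N ->
        (max_codegree 1 (layer H i))%:R <=
        T%:R ^+ i.-1 * ln (T%:R : R) `^ ((k%:R - i%:R) / (k%:R - 1))) ->
      (forall i : nat, (3 <= i <= k)%N ->
        (max_codegree i.-1 (layer H i))%:R <=
        T%:R / ln (T%:R : R) ^+ i.+1) ->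
      c * (N%:R / T%:R) * ln (T%:R : R) `^ (1 / (k%:R - 1)) <= (alpha H)%:R.
Proof.
have k2 : 2 <= k%:R :> R by rewrite ler_nat.
pose M : R := expR (32 * k%:R).
exists (64 * k%:R)^-1, (Num.truncn (expR M)).+1; split.
  by rewrite invr_gt0; lra.
move=> N T N_gt0 N_large T_gt0 lnN_T T_N V H cardV sizeH bouqH deg _.
have M1 : 1 <= M by apply: le_trans (expR_ge1Dx _); lra.
have N0 : 0 < N%:R :> R by rewrite ltr0n.
have T0 : 0 < T%:R :> R by rewrite ltr0n.
have lnN : M <= ln N%:R.
  rewrite -[M]expRK ler_ln ?posrE ?expR_gt0 //; apply: ltW.
  by apply: lt_le_trans (truncnS_gt _) _; rewrite ler_nat.
have MT : M <= T%:R.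
  have ln1 := le_trans M1 lnN; apply: le_trans lnN_T; apply: (le_trans lnN).
  by rewrite -[X in X <= _]expr1; apply: ler_weXn2l.
set L := ln T%:R in deg *.
have TE : expR L = T%:R by rewrite /L lnK // posrE.
have L_large : 32 * k%:R <= L.
  by rewrite -[X in X <= _]expRK ler_ln ?posrE ?expR_gt0.
have L1 : 1 <= L by lra.
set s := L `^ (1 / (k%:R - 1)).
have s_pow m : s ^+ m = L `^ (m%:R / (k%:R - 1)).
  by rewrite -powR_mulrn ?powR_ge0 // /s -powRrM; congr (_ `^ _); ring.
rewrite -cardV -TE; apply: alpha_ge_expR => //.
- by rewrite -[X in X <= _](powRr0 L) ler_powR // divr_ge0 //; lra.
- rewrite s_pow -subn1 natrB ?(ltnW hk) // divff ?powRr1 //; first lra.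
  by rewrite gt_eqF //; lra.
- rewrite cardV TE.
  apply: le_trans (_ : T%:R ^+ (4 * k) <= _).
    by apply: ler_weXn2l; [lra|rewrite (leq_mul2l 4 2)].
  have N_pow : (N%:R `^ (1 / (4 * k%:R)) : R) ^+ (4 * k) = N%:R.
    rewrite -powR_mulrn ?powR_ge0 // -powRrM natrM mul1r mulVf ?powRr1 ?ler0n //.
    by rewrite gt_eqF //; lra.
  by rewrite -[X in _ <= X]N_pow; apply: lerXn2r; rewrite ?nnegrE ?powR_ge0 ?ler0n.
move=> i ik; rewrite TE s_pow natrB; last by case/andP: ik.
rewrite -natrM; apply: le_trans (_ : (#|V| * max_codegree 1 (layer H i))%:R <= _).
  by rewrite ler_nat layer_card_le.
by rewrite natrM; apply: ler_wpM2l; [exact: ler0n|exact: deg].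
Qed.
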